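(* Let $(M,d)$ be a complete separable metric space. Suppose that for every countable ordinal $\alpha<\omega_1$ the metric space $(\mathrm{S}_\alpha(\mathbb{Q}),d_\infty)$ bi-Lipschitzly embeds into $(M,d)$. Then every separable metric space bi-Lipschitzly embeds into $(M,d)$.
   Context: Notation: $[\mathbb{N}]^{<\omega}$ denotes the set of finite subsets of $\mathbb{N}$; for finite $A,B\subset\mathbb{N}$ and $n\in\mathbb{N}$ write $n\le A<B$ if $n\le\min A\le\max A<\min B$. Schreier families $\mathrm{S}_\alpha\subset[\mathbb{N}]^{<\omega}$, $\alpha<\omega_1$, are defined recursively: $\mathrm{S}_0=\{\{n\}:n\in\mathbb{N}\}$; $\mathrm{S}_{\alpha+1}=\{\bigcup_{j=1}^n E_j: n\in\mathbb{N}, E_j\in\mathrm{S}_\alpha, n\le E_1<E_2<\dots<E_n\}$; for a limit ordinal $\beta$, with a fixed sequence $(\alpha_n)$ of ordinals increasing to $\beta$, $\mathrm{S}_\beta=\{A\in[\mathbb{N}]^{<\omega}:\exists n\in\mathbb{N},\ n\le A \text{ and } A\in\mathrm{S}_{\alpha_n}\}$. For a countable set $\mathbb{E}\subset\mathbb{R}$, $\mathrm{S}_\alpha(\mathbb{E})=\{\sum_{i\in G}c_ie_i: G\in\mathrm{S}_\alpha,\ c_i\in\mathbb{E}\}\subset c_{00}$, where $(e_i)$ is the unit vector basis, equipped with the metric $d_\infty$ induced by the sup norm of $c_0$. A map $f:X\to Y$ between metric spaces is a bi-Lipschitz embedding if there are $s>0$, $D\ge1$ with $s\,d_X(x,y)\le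 d_Y(f(x),f(y))\le sD\,d_X(x,y)$ for all $x,y$. *)

(* Defs.v *)
From Stdlib Require Import Reals QArith Qreals List.
From Coquelicot Require Import Coquelicot.
Open Scope R_scope.

Definition is_metric {X : Type} (d : X -> X -> R) : Prop :=
  (forall x y, 0 <= d x y) /\
  (forall x y, d x y = 0 <-> x = y) /\
  (forall x y, d x y = d y x) /\
  (forall x y z, d x z <= d x y + d y z).

Definition complete {X : Type} (d : X -> X -> R) : Prop :=
  forall u : nat -> X,
    (forall eps, 0 < eps -> exists N, forall m n, (N <= m)%nat -> (N <= n)%nat ->
        d (u m) (u n) < eps) ->
    exists l, forall eps, 0 < eps -> exists N, forall n, (N <= n)%nat -> d (u n) l < eps.

(* countable dense subset, enumerated by a partial sequence (allows empty X) *)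
Definition separable {X : Type} (d : X -> X -> R) : Prop :=
  exists s : nat -> option X,
    forall x eps, 0 < eps -> exists n y, s n = Some y /\ d x y < eps.

Definition bilip_embeds {X Y : Type} (dX : X -> X -> R) (dY : Y -> Y -> R) : Prop :=
  exists (f : X -> Y) (s D : R), 0 < s /\ 1 <= D /\
    forall x y, s * dX x y <= dY (f x) (f y) /\ dY (f x) (f y) <= s * D * dX x y.

(* OL f represents the limit of the sequence alpha_1 = f 0, alpha_2 = f 1, ...
   i.e. alpha_n = f (n-1). *)
Inductive Ord : Type :=
| OZ : Ord
| OS : Ord -> Ord
| OL : (nat -> Ord) -> Ord.

Inductive ole : Ord -> Ord -> Prop :=
| ole_Z t : ole OZ t
| ole_SS a b : ole a b -> ole (OS a) (OS b)
| ole_R a b : ole a b -> ole a (OS b)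
| ole_L f b : (forall n, ole (f n) b) -> ole (OL f) b
| ole_LR a f n : ole a (f n) -> ole a (OL f).

Definition olt (a b : Ord) : Prop := ole (OS a) b.
Definition oeq (a b : Ord) : Prop := ole a b /\ ole b a.

(* well-formed trees: limits are limits of strictly increasing sequences;
   their values are exactly the countable ordinals *)
Fixpoint valid (t : Ord) : Prop :=
  match t with
  | OZ => True
  | OS a => valid a
  | OL f => (forall n, valid (f n)) /\ (forall n, olt (f n) (f (S n)))
  end.

(* A fixed choice of fundamental sequences: a set T of valid trees, closed
   under immediate subtrees, containing exactly one representative of each
   countable ordinal. *)
Definition fundamental_system (T : Ord -> Prop) : Prop :=
  (forall t, T t -> valid t) /\
  (forall t, T t -> match t with
                    | OZ => True
                    | OS a => T a
                    | OL f => forall n, T (f n)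
                    end) /\
  (forall t, valid t -> exists u, T u /\ oeq t u) /\
  (forall u v, T u -> T v -> oeq u v -> u = v).

(* finite subsets of N = {1,2,...} are represented by lists (read as sets) *)
Definition seteq (A B : list nat) : Prop := forall k, In k A <-> In k B.

Definition nle (n : nat) (A : list nat) : Prop := forall a, In a A -> (n <= a)%nat.

Definition successive (Es : list (list nat)) : Prop :=
  forall i j, (i < j)%nat -> (j < length Es)%nat ->
    forall a b, In a (nth i Es nil) -> In b (nth j Es nil) -> (a < b)%nat.

Fixpoint Schreier (t : Ord) (A : list nat) : Prop :=
  match t with
  | OZ => exists n, (1 <= n)%nat /\ seteq A (n :: nil)
  | OS a => exists (n : nat) (Es : list (list nat)),
      (1 <= n)%nat /\ length Es = n /\
      (forall E, In E Es -> Schreier a E) /\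
      nle n (nth 0 Es nil) /\ successive Es /\
      seteq A (concat Es)
  | OL f => exists n, (1 <= n)%nat /\ nle n A /\ Schreier (f (n - 1)%nat) A
  end.

Definition SQ (t : Ord) (x : nat -> R) : Prop :=
  exists G, Schreier t G /\
    (forall i, ~ In i G -> x i = 0) /\
    (forall i, exists q : Q, x i = Q2R q).

Definition SQtype (t : Ord) : Type := { x : nat -> R | SQ t x }.

Definition dinf (x y : nat -> R) : R :=
  real (Lub_Rbar (fun r => exists i, r = Rabs (x i - y i))).

Definition dSQ (t : Ord) (x y : SQtype t) : R := dinf (proj1_sig x) (proj1_sig y).

(* Main.v *)
(* By Aharoni's theorem every separable metric space embeds into c_0, so it is enough to
   embed the countable set c_00(Q), dense in c_0, into M; completeness does the rest.
   The attempts to embed longer and longer pieces of c_00(Q) with constant C, recorded with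
   precision 2^-k in a countable dense subset of M, form a countable tree whose infinite
   branches converge to embeddings. An embedding of S_alpha(Q) into M maps the tree of
   initial segments of members of S_alpha into it, because spreading e_1, ..., e_k to
   e_{m_1}, ..., e_{m_k} is isometric. If for every integer constant the tree were well
   founded, its rank would be a countable ordinal; the supremum of these countably many
   ranks would be exceeded by the rank of some S_alpha. *)
Require Import Defs.
From Stdlib Require Import Reals QArith Qreals List.
From Coquelicot Require Import Coquelicot.
From Stdlib Require Import Lra Lia Cantor Classical ClassicalEpsilon
  FunctionalExtensionality.

Open Scope nat_scope.

(** * Ordinals and ranks of families of finite sets *)

Fixpoint oadd (a b : Ord) : Ord :=
  match b with
  | OZ => a
  | OS b' => OS (oadd a b')
  | OL f => OL (fun n => oadd a (f n))
  end.

Lemma ole_refl a : ole a a.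
Proof.
  induction a as [|a IH|f IH]; [constructor|now constructor|].
  apply ole_L; intro n; now apply ole_LR with n.
Qed.

Lemma ole_oadd_l a b : ole a (oadd a b).
Proof.
  induction b as [|b IH|f IH]; simpl; [apply ole_refl|now constructor|].
  now apply ole_LR with 0.
Qed.

Lemma ole_oadd_r a b : ole b (oadd a b).
Proof.
  induction b as [|b IH|f IH]; simpl; [constructor|now constructor|].
  apply ole_L; intro n; now apply ole_LR with n.
Qed.

Lemma oadd_mono a b c : ole b c -> ole (oadd a b) (oadd a c).
Proof.
  induction 1; simpl; [apply ole_oadd_l|now constructor..|].
  now apply ole_LR with n.
Qed.

Lemma valid_oadd a b : valid a -> valid b -> valid (oadd a b).
Proof.
  intros Ha; induction b as [|b IH|f IH]; simpl; auto.
  intros [H1 H2]; split; [auto|].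
  intro n; exact (oadd_mono a _ _ (H2 n)).
Qed.

Fixpoint partial_sum (f : nat -> Ord) (n : nat) : Ord :=
  match n with
  | O => f 0
  | S n' => oadd (partial_sum f n') (OS (f (S n')))
  end.

(** A valid limit needs a strictly increasing sequence, so [f] is replaced by the partial sums of f
    0 + (f 1 + 1) + (f 2 + 1) + ...; each summand after the first is a successor, which makes the
    growth strict. *)
Lemma countable_upper_bound (f : nat -> Ord) :
  (forall n, valid (f n)) ->
  exists g, valid (OL g) /\ forall n, ole (f n) (g n).
Proof.
  intro Hf; exists (partial_sum f); split; [split|].
  - intro n; induction n as [|n IH]; simpl; [apply Hf|].
    apply (valid_oadd (partial_sum f n) (OS (f (S n)))); simpl; auto.
  - intro n; apply ole_SS, ole_oadd_l.
  - intros [|n]; simpl; [apply ole_refl|].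
    apply ole_R, ole_oadd_r.
Qed.

(* [rank_ge t F N]: the tree of increasing sequences [m_1 < m_2 < ...] above [N] that
   extend to members of [F] has rank at least [t]. *)
Fixpoint rank_ge (t : Ord) (F : list nat -> Prop) (N : nat) : Prop :=
  match t with
  | OZ => exists E, (forall e, In e E -> N < e) /\ F E
  | OS a => exists m, N < m /\ rank_ge a (fun E => F (m :: E)) m
  | OL f => forall n, rank_ge (f n) F N
  end.

Lemma rank_ge_mono t : forall (F F' : list nat -> Prop) N N',
  N' <= N -> (forall E, (forall e, In e E -> N < e) -> F E -> F' E) ->
  rank_ge t F N -> rank_ge t F' N'.
Proof.
  induction t as [|a IH|f IH]; simpl; intros F F' N N' HN HF.
  - intros (E & HE & H); exists E; split; [|auto].
    intros e He; specialize (HE e He); lia.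
  - intros (m & Hm & H); exists m; split; [lia|].
    revert H; apply IH; [lia|]; intros E HE; apply HF.
    intros e [<-|He]; [lia|]; specialize (HE e He); lia.
  - intros H n; exact (IH n F F' N N' HN HF (H n)).
Qed.

(** A parent node ranks at least as high as its child. In the successor case [m] stays the first
    element and the induction hypothesis drops the next one, [m2], instead. *)
Lemma rank_ge_drop a : forall (F : list nat -> Prop) N m,
  N < m -> rank_ge a (fun E => F (m :: E)) m -> rank_ge a F N.
Proof.
  induction a as [|a IH|f IH]; simpl; intros F N m Hm.
  - intros (E & HE & H); exists (m :: E); split; [|auto].
    intros e [<-|He]; [lia|]; specialize (HE e He); lia.
  - intros (m2 & Hm2 & H); exists m; split; [lia|].
    exact (IH (fun E => F (m :: E)) m m2 Hm2 H).
  - intros H n; exact (IH n F N m Hm (H n)).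
Qed.

Lemma rank_ge_ole a b : ole a b -> forall F N, rank_ge b F N -> rank_ge a F N.
Proof.
  induction 1 as [t|a b _ IH|a b _ IH|f b _ IH|a f n _ IH]; intros F N Hb; simpl in *.
  (* Any rank bound yields a member of [F]: follow the successors down, passing to the term [f 0] at
     limits. *)
  - revert F N Hb; induction t as [|a IH|f IH]; simpl; intros F N; [auto| |].
    + intros (m & Hm & H); destruct (IH _ _ H) as (E & HE & HF).
      exists (m :: E); split; [|exact HF].
      intros e [<-|He]; [lia|]; specialize (HE e He); lia.
    + intro H; exact (IH 0 F N (H 0)).
  - destruct Hb as (m & Hm & H); exists m; auto.
  - destruct Hb as (m & Hm & H); exact (rank_ge_drop a F N m Hm (IH _ _ H)).
  - intro n; auto.
  - auto.
Qed.

(** The two blocks [{m} < E] are admissible with n = 2 because [m] is at least 2. So prepending one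
    element costs one successor. *)
Lemma Schreier_cons a m E :
  1 < m -> (forall e, In e E -> m < e) ->
  Schreier a (m :: nil) -> Schreier a E -> Schreier (OS a) (m :: E).
Proof.
  intros Hm HE H1 H2; simpl; exists 2, ((m :: nil) :: E :: nil).
  repeat split; [lia|..|].
  - intros E' [<-|[<-|[]]]; auto.
  - intros x [<-|[]]; lia.
  - intros i j Hij Hj x y; simpl in Hj.
    destruct i as [|[|i]], j as [|[|j]]; simpl; try lia.
    intros [<-|[]] Hy; auto.
  - simpl; rewrite app_nil_r; auto.
  - simpl; rewrite app_nil_r; auto.
Qed.

Lemma Schreier_singleton t : forall m, 1 <= m -> Schreier t (m :: nil).
Proof.
  induction t as [|a IH|f IH]; intros m Hm; simpl.
  - exists m; split; [auto|intro k; tauto].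
  - exists 1, ((m :: nil) :: nil); repeat split; simpl; try lia; auto.
    + intros E [<-|[]]; auto.
    + intros x [<-|[]]; auto.
    + intros i j Hij Hj; simpl in Hj; lia.
  - exists 1; repeat split; auto.
    intros x [<-|[]]; auto.
Qed.

Lemma rank_ge_Schreier t : forall N, rank_ge t (Schreier t) N.
Proof.
  induction t as [|a IH|f IH]; intro N; simpl.
  - exists (S N :: nil); split; [intros e [<-|[]]; lia|].
    exists (S N); split; [lia|intro k; tauto].
  - exists (N + 2); split; [lia|].
    apply (rank_ge_mono a (Schreier a) _ (N + 2) (N + 2)); [lia| |apply IH].
    intros E HE H; apply (Schreier_cons a); auto; [lia|].
    apply Schreier_singleton; lia.
  (* Sets above [N + S n] satisfy the condition [S n <= A] under which the limit clause admits
     members of [Schreier (f n)]; hence the induction must allow every threshold [N]. *)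
  - intro n; apply (rank_ge_mono (f n) (Schreier (f n)) _ (N + S n) N); [lia| |apply IH].
    intros E HE H; exists (S n); repeat split; [lia| |].
    + intros e He; specialize (HE e He); lia.
    + replace (S n - 1) with n by lia; exact H.
Qed.

(** * Finitely supported rational sequences *)

Fixpoint decode_list {A : Type} (v : nat -> A) (k n : nat) : list A :=
  match k with
  | O => nil
  | S k' => let (a, b) := of_nat n in v a :: decode_list v k' b
  end.

Definition enum_list {A : Type} (v : nat -> A) (n : nat) : list A :=
  let (k, m) := of_nat n in decode_list v k m.

Lemma enum_list_onto {A : Type} (v : nat -> A) (l : list nat) :
  exists n, enum_list v n = map v l.
Proof.
  assert (H : exists m, decode_list v (length l) m = map v l).
  { induction l as [|a l [m IH]]; [now exists 0|].
    exists (to_nat (a, m)); cbn [length decode_list].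
    now rewrite cancel_of_to, IH. }
  destruct H as [m Hm]; exists (to_nat (length l, m)).
  unfold enum_list; now rewrite cancel_of_to.
Qed.

(** The length is the first component of the Cantor pair coded by [n]. Consequently [ratvec i] is
    supported below [i], and a set with [k] elements has room for the first [k] vectors. *)
Lemma enum_list_length {A : Type} (v : nat -> A) n : length (enum_list v n) <= n.
Proof.
  unfold enum_list; destruct (of_nat n) as [k m] eqn:Hn.
  assert (H : forall k m, length (decode_list v k m) = k).
  { clear; induction k as [|k IH]; intro m; simpl; [auto|].
    destruct (of_nat m); simpl; now rewrite IH. }
  rewrite H; pose proof (to_nat_non_decreasing k m) as H1.
  rewrite <- Hn, cancel_to_of in H1; lia.
Qed.

(** For distinct entries, G = [m_0; m_1; ...] gives the vector sum of v_j e_{m_j}; coordinates of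
    [v] from [length G] on are discarded. *)
Fixpoint spread (G : list nat) (v : nat -> R) (p : nat) : R :=
  match G with
  | nil => 0%R
  | m :: G' => if Nat.eqb p m then v 0 else spread G' (fun j => v (S j)) p
  end.

Lemma spread_cases G : forall (v w : nat -> R) p,
  (spread G v p = 0%R /\ spread G w p = 0%R) \/
  (exists j, spread G v p = v j /\ spread G w p = w j).
Proof.
  induction G as [|m G IH]; intros v w p; simpl; [now left|].
  destruct (Nat.eqb p m); [right; now exists 0|].
  destruct (IH (fun j => v (S j)) (fun j => w (S j)) p) as [H|[j H]]; [now left|].
  right; now exists (S j).
Qed.

Lemma spread_nth G : forall (v : nat -> R) j,
  NoDup G -> j < length G -> spread G v (nth j G 0) = v j.
Proof.
  induction G as [|m G IH]; intros v j HG Hj; simpl in *; [lia|].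
  inversion HG as [|? ? Hm HG']; subst.
  destruct j as [|j]; [now rewrite Nat.eqb_refl|].
  destruct (Nat.eqb_spec (nth j G 0) m) as [He|_].
  - exfalso; apply Hm; rewrite <- He; apply nth_In; lia.
  - apply (IH (fun j => v (S j))); [auto|lia].
Qed.

Lemma spread_out G : forall (v : nat -> R) p, ~ In p G -> spread G v p = 0%R.
Proof.
  induction G as [|m G IH]; intros v p Hp; simpl in *; [auto|].
  destruct (Nat.eqb_spec p m) as [He|_]; [exfalso; apply Hp; auto|].
  apply IH; tauto.
Qed.

(** Makes consecutive nodes of a branch compatible: a vector that already fits on [G] has the same
    image after [G] is prolonged. *)
Lemma spread_app G H : forall (v : nat -> R),
  (forall j, length G <= j -> v j = 0%R) -> spread (G ++ H) v = spread G v.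
Proof.
  intros v Hv; apply functional_extensionality; intro p; revert v Hv.
  induction G as [|m G IH]; intros v Hv; simpl in *.
  - destruct (spread_cases H v v p) as [[E _]|[j [E _]]]; rewrite E; auto.
    apply Hv; lia.
  - destruct (Nat.eqb p m); [auto|].
    apply IH; intros j Hj; apply Hv; lia.
Qed.

Open Scope R_scope.

Definition null_seq (x : nat -> R) : Prop :=
  forall eps, 0 < eps -> exists N, forall i, (N <= i)%nat -> Rabs (x i) <= eps.

Definition nat_rat (n : nat) : Q :=
  let (a, m) := of_nat n in
  let (b, c) := of_nat m in Qmake (Z.of_nat a - Z.of_nat b) (Pos.of_succ_nat c).

Lemma nat_rat_dense x eps : 0 < eps -> exists n, Rabs (x - Q2R (nat_rat n)) <= eps.
Proof.
  intro Heps.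
  destruct (archimed_cor1 eps Heps) as (N & HN & HN0).
  destruct N as [|c]; [lia|].
  set (z := up (x * INR (S c))).
  exists (to_nat (Z.to_nat z, to_nat (Z.to_nat (- z), c))).
  unfold nat_rat; rewrite !cancel_of_to.
  replace (Z.of_nat (Z.to_nat z) - Z.of_nat (Z.to_nat (- z)))%Z with z by lia.
  unfold Q2R; simpl Qnum; simpl Qden.
  replace (IZR (Z.pos (Pos.of_succ_nat c))) with (INR (S c))
    by (rewrite INR_IZR_INZ; f_equal; lia).
  assert (Hpos : 0 < INR (S c)) by (apply lt_0_INR; lia).
  destruct (archimed (x * INR (S c))) as [H1 H2]; fold z in H1, H2.
  assert (E : x - IZR z * / INR (S c) = (x * INR (S c) - IZR z) * / INR (S c))
    by (field; lra).
  rewrite E, Rabs_mult, (Rabs_pos_eq (/ _)) by (left; now apply Rinv_0_lt_compat).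
  apply Rle_trans with (1 * / INR (S c)); [|lra].
  apply Rmult_le_compat_r; [left; now apply Rinv_0_lt_compat|].
  apply Rabs_le; lra.
Qed.

(* [ratvec] enumerates the finitely supported rational sequences. *)
Definition ratvec (i j : nat) : R := nth j (map Q2R (enum_list nat_rat i)) 0.

Lemma ratvec_support i j : (i <= j)%nat -> ratvec i j = 0.
Proof.
  intro H; apply nth_overflow; rewrite length_map.
  pose proof (enum_list_length nat_rat i); lia.
Qed.

Lemma ratvec_rational i j : exists q : Q, ratvec i j = Q2R q.
Proof.
  unfold ratvec; rewrite <- RMicromega.Q2R_0, map_nth; eauto.
Qed.

Lemma ratvec_dense x eps :
  null_seq x -> 0 < eps -> exists i, forall j, Rabs (x j - ratvec i j) <= eps.
Proof.
  intros Hx Heps; destruct (Hx eps Heps) as [N HN].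
  destruct (choice (fun j n => Rabs (x j - Q2R (nat_rat n)) <= eps)) as [c Hc].
  { intro j; now apply nat_rat_dense. }
  destruct (enum_list_onto nat_rat (map c (seq 0 N))) as [i Hi].
  exists i; intro j; unfold ratvec; rewrite Hi, !map_map.
  destruct (Nat.lt_ge_cases j N) as [Hj|Hj].
  - rewrite (nth_indep _ 0 (Q2R (nat_rat (c 0%nat)))) by (now rewrite length_map, length_seq).
    rewrite (map_nth (fun k => Q2R (nat_rat (c k)))), seq_nth by auto.
    apply Hc.
  - rewrite nth_overflow by (now rewrite length_map, length_seq).
    rewrite Rminus_0_r; auto.
Qed.

(** [dinf] is the real part of an extended supremum; the bound [B] excludes [p_infty] and the
    coordinate 0 excludes [m_infty]. *)
Lemma dinf_spec (x y : nat -> R) B :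
  (forall i, Rabs (x i - y i) <= B) ->
  (forall i, Rabs (x i - y i) <= dinf x y) /\ dinf x y <= B.
Proof.
  intro HB; unfold dinf.
  destruct (Lub_Rbar_correct (fun r => exists i, r = Rabs (x i - y i))) as [H1 H2].
  destruct (Lub_Rbar _) as [l| |]; simpl.
  - split; [intro i; apply (H1 (Rabs (x i - y i))); eauto|].
    apply (H2 (Finite B)); intros r [i ->]; apply HB.
  - exfalso; apply (H2 (Finite B)); intros r [i ->]; apply HB.
  - exfalso; apply (H1 (Rabs (x 0%nat - y 0%nat))); eauto.
Qed.

(** * Aharoni's theorem *)

(** Lists all integer powers of two in one sequence, so that radii become both arbitrarily large and
    arbitrarily small. *)
Definition scale (k : nat) : R := if Nat.even k then 2 ^ Nat.div2 k else / 2 ^ Nat.div2 k.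

Lemma scale_pos k : 0 < scale k.
Proof.
  unfold scale; destruct (Nat.even k); [|apply Rinv_0_lt_compat]; apply pow_lt; lra.
Qed.

Lemma pow2_unbounded x : exists j, x < 2 ^ j.
Proof.
  destruct (Pow_x_infinity 2 ltac:(rewrite Rabs_pos_eq; lra) (x + 1)) as [N HN].
  exists N; specialize (HN N (le_n N)).
  rewrite Rabs_pos_eq in HN by (apply pow_le; lra); lra.
Qed.

Lemma scale_finite a b :
  0 < a -> exists K, forall k, (K <= k)%nat -> scale k < a \/ b < scale k.
Proof.
  intro Ha; destruct (pow2_unbounded (/ a)) as [J1 H1], (pow2_unbounded b) as [J2 H2].
  exists (2 * (J1 + J2))%nat; intros k Hk.
  assert (Hd : (J1 + J2 <= Nat.div2 k)%nat).
  { rewrite <- (Nat.div2_double (J1 + J2)); now apply Nat.div2_le_mono. }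
  unfold scale; destruct (Nat.even k); [right|left].
  - apply Rlt_le_trans with (1 := H2); apply Rle_pow; [lra|lia].
  - rewrite <- (Rinv_inv a); apply Rinv_lt_contravar.
    + apply Rmult_lt_0_compat; [now apply Rinv_0_lt_compat|apply pow_lt; lra].
    + apply Rlt_le_trans with (1 := H1); apply Rle_pow; [lra|lia].
Qed.

Lemma least_nat (P : nat -> Prop) n :
  P n -> exists m, P m /\ forall k, (k < m)%nat -> ~ P k.
Proof.
  induction n as [n IH] using (well_founded_induction Wf_nat.lt_wf); intro Hn.
  destruct (classic (exists k, (k < n)%nat /\ P k)) as [(k & Hk & HP)|H]; [eauto|].
  exists n; split; [auto|]; intros k Hk HP; apply H; eauto.
Qed.

Lemma scale_dyadic D : 0 < D -> exists k, scale k <= D <= 2 * scale k.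
Proof.
  intro HD; destruct (Rle_lt_dec 1 D) as [H1|H1].
  - destruct (pow2_unbounded D) as [J HJ].
    destruct (least_nat (fun j => D < 2 ^ j) J HJ) as ([|m] & Hm & Hl); simpl in Hm; [lra|].
    specialize (Hl m (Nat.lt_succ_diag_r m)).
    exists (2 * m)%nat; unfold scale.
    replace (Nat.even (2 * m)) with true by (symmetry; apply Nat.even_spec; now exists m).
    rewrite Nat.div2_double; lra.
  - destruct (pow2_unbounded (/ D)) as [J HJ].
    destruct (least_nat (fun j => / D < 2 ^ j) J HJ) as ([|m] & Hm & Hl).
    { simpl in Hm; rewrite <- Rinv_1 in Hm at 1; apply Rinv_lt_contravar in H1; lra. }
    specialize (Hl m (Nat.lt_succ_diag_r m)).
    exists (S (2 * (S m))); unfold scale.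
    replace (Nat.even (S (2 * S m))) with false
      by (symmetry; rewrite Nat.even_succ, Nat.odd_mul; reflexivity).
    replace (Nat.div2 (S (2 * S m))) with (S m) by (symmetry; apply Nat.div2_succ_double).
    assert (Hp : 0 < 2 ^ m) by (apply pow_lt; lra).
    simpl in *; split.
    + rewrite <- (Rinv_inv D); apply Rinv_le_contravar; [now apply Rinv_0_lt_compat|lra].
    + apply Rnot_lt_le in Hl; rewrite <- (Rinv_inv D).
      replace (2 * / (2 * 2 ^ m)) with (/ 2 ^ m) by (field; lra).
      apply Rinv_le_contravar; lra.
Qed.

Section Bumps.

Context {X : Type} (d : X -> X -> R) (o : X) (p : nat -> X) (Hd : is_metric d).

Fixpoint clearance (r : R) (n : nat) (x : X) : R :=
  match n with
  | O => d x o - r / 2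
  | S n' => Rmin (clearance r n' x) (d x (p n') - r / 2)
  end.

(* A Lipschitz substitute for the distance to the complement of
   [B(p n, 2 r)] minus the balls of radius [r / 2] around [o, p 0, ..., p (n - 1)]. *)
Definition bump (r : R) (n : nat) (x : X) : R :=
  Rmax 0 (Rmin (2 * r - d x (p n)) (clearance r n x)).

Lemma bump_lipschitz r n x y : Rabs (bump r n x - bump r n y) <= d x y.
Proof.
  destruct Hd as (Hd0 & _ & Hs & Ht).
  assert (Hdist : forall z, Rabs (d x z - d y z) <= d x y).
  { intro z; pose proof (Ht x y z); pose proof (Ht y x z); rewrite (Hs y x) in *.
    apply Rabs_le; lra. }
  assert (Hc : Rabs (clearance r n x - clearance r n y) <= d x y).
  { induction n as [|n IH]; simpl.
    - replace (_ - _) with (d x o - d y o) by lra; apply Hdist.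
    - pose proof (Hdist (p n)) as H; apply Rabs_le_between in H.
      apply Rabs_le_between in IH; apply Rabs_le.
      unfold Rmin; repeat destruct Rle_dec; lra. }
  pose proof (Hdist (p n)) as H; apply Rabs_le_between in H.
  apply Rabs_le_between in Hc; apply Rabs_le.
  unfold bump, Rmax, Rmin; repeat destruct Rle_dec; lra.
Qed.

Lemma clearance_le_base r n x : clearance r n x <= d x o - r / 2.
Proof.
  induction n as [|n IH]; simpl; [lra|].
  apply Rle_trans with (1 := Rmin_l _ _); exact IH.
Qed.

Lemma clearance_le_point r m n x : (m < n)%nat -> clearance r n x <= d x (p m) - r / 2.
Proof.
  induction n as [|n IH]; intro H; simpl; [lia|].
  destruct (Nat.eq_dec m n) as [->|Hne]; [apply Rmin_r|].
  apply Rle_trans with (1 := Rmin_l _ _); apply IH; lia.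
Qed.

Lemma clearance_ge r n x :
  r <= d x o -> (forall m, (m < n)%nat -> r <= d x (p m)) -> r / 2 <= clearance r n x.
Proof.
  intros Ho; induction n as [|n IH]; intro H; simpl; [lra|].
  apply Rmin_glb; [apply IH; auto|].
  specialize (H n (Nat.lt_succ_diag_r n)); lra.
Qed.

Lemma bump_nonneg r n x : 0 <= bump r n x.
Proof. apply Rmax_l. Qed.

Lemma bump_small r n x : 0 <= r -> bump r n x <= 2 * r.
Proof.
  intro Hr; apply Rmax_lub; [lra|].
  apply Rle_trans with (1 := Rmin_l _ _); pose proof (proj1 Hd x (p n)); lra.
Qed.

Lemma bump_near_base r n x : d x o <= r / 2 -> bump r n x = 0.
Proof.
  intro H; apply Rmax_left; apply Rle_trans with (1 := Rmin_r _ _).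
  pose proof (clearance_le_base r n x); lra.
Qed.

Lemma bump_near_point r m n x : (m < n)%nat -> d x (p m) <= r / 2 -> bump r n x = 0.
Proof.
  intros Hm H; apply Rmax_left; apply Rle_trans with (1 := Rmin_r _ _).
  pose proof (clearance_le_point r m n x Hm); lra.
Qed.

Lemma bump_far r n x : 2 * r <= d x (p n) -> bump r n x = 0.
Proof.
  intro H; apply Rmax_left; apply Rle_trans with (1 := Rmin_l _ _); lra.
Qed.

Context (Hp : forall x eps, 0 < eps -> exists n, d x (p n) < eps).

(** Take the first [n] with [p n] within [r] of [x]. Then [x] is at distance at least [r] from [o]
    and all earlier points, so its bump is at least [r / 2], while [y] lies outside the ball of
    radius [2 * r] around [p n]. *)
Lemma bump_separates r x y :
  0 < r -> r <= d x o -> 3 * r <= d x y ->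
  exists n, r / 2 <= Rabs (bump r n x - bump r n y).
Proof.
  intros Hr Ho Hxy; destruct (Hp x r Hr) as [n0 Hn0].
  destruct (least_nat (fun n => d x (p n) < r) n0 Hn0) as (n & Hn & Hl).
  exists n; destruct Hd as (_ & _ & Hs & Ht).
  rewrite (bump_far r n y), Rminus_0_r, Rabs_pos_eq by
    first [apply bump_nonneg | pose proof (Ht x (p n) y); rewrite (Hs (p n) y) in *; lra].
  apply Rle_trans with (2 := Rmax_r _ _); apply Rmin_glb; [lra|].
  apply clearance_ge; [auto|].
  intros m Hm; apply Rnot_lt_le; auto.
Qed.

(** At large scales [x] lies in the hole around [o]; at small scales a bump is at most twice the
    scale. At each of the finitely many scales between, a point [p m] close to [x] kills all bumps
    with [n > m]. *)
Lemma bump_null x :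
  null_seq (fun i => let (k, n) := of_nat i in bump (scale k) n x).
Proof.
  intros eps Heps.
  destruct (scale_finite (eps / 2) (2 * d x o) ltac:(lra)) as [K HK].
  assert (HN : exists N, forall k n, (k < K)%nat -> (N <= n)%nat -> bump (scale k) n x = 0).
  { clear HK; induction K as [|K [N IH]]; [exists 0%nat; lia|].
    pose proof (scale_pos K) as Hs.
    destruct (Hp x (scale K / 2) ltac:(lra)) as [m Hm].
    exists (N + S m)%nat; intros k n Hk Hn.
    destruct (Nat.eq_dec k K) as [->|Hne]; [|apply IH; lia].
    apply bump_near_point with m; [lia|lra]. }
  destruct HN as [N HN].
  (* Every pair with [k < K] and [n < N] has a smaller Cantor code than this one. *)
  exists (to_nat (K + N, K + N))%nat; intros i Hi.
  destruct (of_nat i) as [k n] eqn:Ei.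
  pose proof (scale_pos k) as Hs.
  rewrite Rabs_pos_eq by apply bump_nonneg.
  destruct (Nat.lt_ge_cases k K) as [Hk|Hk].
  - rewrite HN; [lra|auto|].
    apply Nat.nlt_ge; intro Hn.
    rewrite <- (cancel_to_of i), Ei in Hi.
    pose proof (to_nat_spec (K + N) (K + N)); pose proof (to_nat_spec k n); nia.
  - destruct (HK k Hk) as [H|H].
    + apply Rle_trans with (1 := bump_small (scale k) n x ltac:(lra)); lra.
    + rewrite bump_near_base; lra.
Qed.

End Bumps.

Lemma aharoni {X : Type} (d : X -> X -> R) (o : X) :
  is_metric d -> separable d ->
  exists F : X -> nat -> R,
    (forall x, null_seq (F x)) /\
    (forall x y i, Rabs (F x i - F y i) <= d x y) /\
    (forall x y, exists i, d x y <= 12 * Rabs (F x i - F y i)).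
Proof.
  intros Hd [s Hs].
  set (p := fun n => match s n with Some x => x | None => o end).
  assert (Hp : forall x eps, 0 < eps -> exists n, d x (p n) < eps).
  { intros x eps Heps; destruct (Hs x eps Heps) as (n & y & Hn & Hy).
    exists n; unfold p; now rewrite Hn. }
  exists (fun x i => let (k, n) := of_nat i in bump d o p (scale k) n x); repeat split.
  - intro x; now apply bump_null.
  - intros x y i; destruct (of_nat i) as [k n]; now apply bump_lipschitz.
  - intros x y; pose proof Hd as (H0 & _ & Hsym & Ht).
    destruct (Rle_lt_or_eq_dec _ _ (H0 x y)) as [Hxy|Hxy].
    2:{ exists 0%nat; rewrite <- Hxy; apply Rmult_le_pos; [lra|apply Rabs_pos]. }
    (* The radius r = [scale k] satisfies 3 r <= d x y <= 6 r, and separation by r / 2 yields the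
       constant 12. *)
    destruct (scale_dyadic (d x y / 3) ltac:(lra)) as (k & Hk1 & Hk2).
    pose proof (scale_pos k) as Hk.
    (* One of [x], [y] is far from [o], so it escapes the hole of the bumps around [o]. *)
    assert (Hn : exists n, scale k / 2 <=
      Rabs (bump d o p (scale k) n x - bump d o p (scale k) n y)).
    { destruct (Rle_lt_dec (scale k) (d x o)) as [Hx|Hx].
      - apply bump_separates; auto; lra.
      - destruct (bump_separates d o p Hd Hp (scale k) y x Hk) as [n Hn].
        + pose proof (Ht x o y); rewrite (Hsym o y) in *; lra.
        + rewrite Hsym; lra.
        + exists n; now rewrite Rabs_minus_sym. }
    destruct Hn as [n Hn]; exists (to_nat (k, n)); rewrite cancel_of_to; lra.
Qed.

(** * The tree of approximate embeddings *)

Lemma half_pow_pos n : 0 < (1 / 2) ^ n.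
Proof. apply pow_lt; lra. Qed.

Lemma half_pow_add n k : (1 / 2) ^ (n + k) <= (1 / 2) ^ n.
Proof.
  rewrite pow_add; pose proof (half_pow_pos n).
  pose proof (pow_incr (1 / 2) 1 k ltac:(lra)) as H1; rewrite pow1 in H1; nra.
Qed.

Lemma half_pow_small eps : 0 < eps -> exists N, (1 / 2) ^ N < eps.
Proof.
  intro Heps.
  destruct (pow_lt_1_zero (1 / 2) ltac:(rewrite Rabs_pos_eq; lra) eps Heps) as [N HN].
  exists N; specialize (HN N (le_n N)).
  rewrite Rabs_pos_eq in HN; [auto|left; apply half_pow_pos].
Qed.

Lemma le_of_half_pow a b K : 0 < K -> (forall n, a <= b + K * (1 / 2) ^ n) -> a <= b.
Proof.
  intros HK H; apply Rnot_lt_le; intro Hab.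
  destruct (half_pow_small ((a - b) / K)) as [N HN].
  { apply Rdiv_lt_0_compat; lra. }
  specialize (H N); apply (Rmult_lt_compat_l K) in HN; [|auto].
  replace (K * ((a - b) / K)) with (a - b) in HN by (field; lra); lra.
Qed.

Lemma fast_cauchy_limit {M : Type} (d : M -> M -> R) (u : nat -> M) :
  is_metric d -> complete d ->
  (forall n, d (u n) (u (S n)) <= 2 * (1 / 2) ^ n) ->
  exists l, forall n, d (u n) l <= 4 * (1 / 2) ^ n.
Proof.
  intros (H0 & Hz & Hs & Ht) Hc Hu.
  assert (Hnk : forall n k, d (u n) (u (n + k)%nat) <= 4 * (1 / 2) ^ n).
  { intros n k.
    (* The subtracted term makes the induction on [k] telescope: it shrinks by exactly the allowed
       step length. *)
    apply Rle_trans with (4 * (1 / 2) ^ n - 4 * (1 / 2) ^ (n + k));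
      [|pose proof (half_pow_pos (n + k)); lra].
    induction k as [|k IH].
    - rewrite Nat.add_0_r, (proj2 (Hz _ _) eq_refl); lra.
    - rewrite Nat.add_succ_r.
      pose proof (Ht (u n) (u (n + k)%nat) (u (S (n + k)))).
      pose proof (Hu (n + k)%nat); simpl pow; lra. }
  destruct (Hc u) as [l Hl].
  - intros eps Heps; destruct (half_pow_small (eps / 8) ltac:(lra)) as [N HN].
    exists N; intros m n Hm Hn.
    pose proof (Hnk N (m - N)%nat) as H1; pose proof (Hnk N (n - N)%nat) as H2.
    replace (N + (m - N))%nat with m in H1 by lia.
    replace (N + (n - N))%nat with n in H2 by lia.
    pose proof (Ht (u m) (u N) (u n)); rewrite (Hs (u m) (u N)) in *; lra.
  - exists l; intro n; apply le_epsilon; intros eps Heps.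
    destruct (Hl eps Heps) as [N HN].
    specialize (HN (n + N)%nat ltac:(lia)); specialize (Hnk n N).
    pose proof (Ht (u n) (u (n + N)%nat) l); lra.
Qed.

(** The sup distance is expressed by single coordinates from below and by arbitrary common bounds
    [B] from above; [C] serves both estimates, with additive error [e]. *)
Definition rough_emb {M : Type} (d : M -> M -> R) (C e : R) (k : nat) (f : nat -> M) : Prop :=
  forall i j, (i < k)%nat -> (j < k)%nat ->
    (forall c, Rabs (ratvec i c - ratvec j c) <= C * d (f i) (f j) + e) /\
    (forall B, (forall c, Rabs (ratvec i c - ratvec j c) <= B) -> d (f i) (f j) <= C * B + e).

(* Nodes of the tree of approximate embeddings are lists [phi] of indices of points of a
   dense sequence [s]; [s (nth i phi 0)] approximates the image of [ratvec i]. *)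
Definition child {M : Type} (d : M -> M -> R) (s : nat -> M) (C : R) (phi' phi : list nat) :=
  length phi' = S (length phi) /\
  (forall i, (i < length phi)%nat ->
     d (s (nth i phi 0%nat)) (s (nth i phi' 0%nat)) <= 2 * (1 / 2) ^ length phi) /\
  rough_emb d C (2 * C * (1 / 2) ^ length phi') (length phi') (fun i => s (nth i phi' 0%nat)).

Lemma infinite_descent {A : Type} (R : A -> A -> Prop) a :
  ~ Acc R a -> exists u : nat -> A, u 0%nat = a /\ forall n, R (u (S n)) (u n).
Proof.
  intro Ha.
  destruct (choice (fun x y => ~ Acc R x -> R y x /\ ~ Acc R y)) as [next Hnext].
  { intro x; apply NNPP; intro H; apply H; exists x; intro Hx; exfalso.
    apply Hx; constructor; intros y Hy; apply NNPP; intro Hy'.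
    apply H; exists y; auto. }
  exists (fun n => Nat.iter n next a); split; [reflexivity|].
  assert (H : forall n, ~ Acc R (Nat.iter n next a)).
  { induction n as [|n IH]; [auto|]; simpl; now apply Hnext. }
  intro n; simpl; now apply Hnext.
Qed.

Lemma embedding_of_branch {M : Type} (d : M -> M -> R) (s : nat -> M) C :
  is_metric d -> complete d -> 1 <= C -> ~ Acc (child d s C) nil ->
  exists f, forall k, rough_emb d C 0 k f.
Proof.
  intros Hd Hc HC Hnil.
  destruct (infinite_descent _ _ Hnil) as (phi & H0 & Hphi).
  assert (Hlen : forall n, length (phi n) = n).
  { induction n as [|n IH]; [now rewrite H0|].
    rewrite (proj1 (Hphi n)); now rewrite IH. }
  (* The entry [i] exists from the node of length [S i] on, so the sequence of approximations starts
     there. *)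
  set (u := fun i n => s (nth i (phi (n + S i)%nat) 0%nat)).
  destruct (choice (fun i l => forall n, d (u i n) l <= 4 * (1 / 2) ^ n)) as [f Hf].
  { intro i; apply fast_cauchy_limit; auto; intro n.
    destruct (Hphi (n + S i)%nat) as (_ & H & _).
    specialize (H i); rewrite Hlen in H; specialize (H ltac:(lia)).
    apply Rle_trans with (1 := H).
    pose proof (half_pow_add n (S i)); lra. }
  exists f; intros k i j _ _.
  (* Compare at a common stage late enough for both entries. The two limits contribute an error of 4
     units of 2^-n each and [rough_emb] contributes [2 * C] units, whence the constants [10 * C] and
     [8 + 2 * C] below. *)
  assert (Hn : forall n,
    let x := s (nth i (phi (S n + S i + S j)%nat) 0%nat) in
    let y := s (nth j (phi (S n + S i + S j)%nat) 0%nat) in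
    Rabs (d x y - d (f i) (f j)) <= 8 * (1 / 2) ^ n /\
    (forall c, Rabs (ratvec i c - ratvec j c) <= C * d x y + 2 * C * (1 / 2) ^ n) /\
    (forall B, (forall c, Rabs (ratvec i c - ratvec j c) <= B) ->
       d x y <= C * B + 2 * C * (1 / 2) ^ n)).
  { intros n x y.
    assert (Hx : d x (f i) <= 4 * (1 / 2) ^ n).
    { replace x with (u i (n + S (S j))%nat) by (unfold u, x; do 3 f_equal; lia).
      apply Rle_trans with (1 := Hf i _); pose proof (half_pow_add n (S (S j))); lra. }
    assert (Hy : d y (f j) <= 4 * (1 / 2) ^ n).
    { replace y with (u j (n + S (S i))%nat) by (unfold u, y; do 3 f_equal; lia).
      apply Rle_trans with (1 := Hf j _); pose proof (half_pow_add n (S (S i))); lra. }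
    destruct Hd as (_ & _ & Hs & Ht).
    pose proof (Ht x (f i) y); pose proof (Ht (f i) (f j) y).
    pose proof (Ht (f i) x (f j)); pose proof (Ht x y (f j)).
    rewrite (Hs (f i) x), (Hs (f j) y) in *.
    split; [apply Rabs_le; lra|].
    destruct (Hphi (n + S i + S j)%nat) as (_ & _ & Hr).
    rewrite Hlen in Hr; destruct (Hr i j ltac:(lia) ltac:(lia)) as [Hl Hu'].
    assert (He : 2 * C * (1 / 2) ^ S (n + S i + S j) <= 2 * C * (1 / 2) ^ n).
    { apply Rmult_le_compat_l; [lra|].
      replace (S (n + S i + S j)) with (n + (S i + S (S j)))%nat by lia; apply half_pow_add. }
    split.
    - intro c; apply Rle_trans with (1 := Hl c), Rplus_le_compat_l, He.
    - intros B HB; apply Rle_trans with (1 := Hu' B HB), Rplus_le_compat_l, He. }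
  split.
  - intro c; rewrite Rplus_0_r; apply le_of_half_pow with (10 * C); [lra|]; intro n.
    destruct (Hn n) as (Hxy & H & _); specialize (H c).
    apply Rabs_le_between in Hxy; pose proof (half_pow_pos n); nra.
  - intros B HB; rewrite Rplus_0_r; apply le_of_half_pow with (8 + 2 * C); [lra|]; intro n.
    destruct (Hn n) as (Hxy & _ & H); specialize (H B HB).
    apply Rabs_le_between in Hxy; lra.
Qed.

(** * Rank bounds from embeddings of Schreier spaces *)

Definition SQ_emb {M : Type} (d : M -> M -> R) (C : R) (t : Ord) (g : (nat -> R) -> M) : Prop :=
  forall x y, SQ t x -> SQ t y ->
    (forall c, Rabs (x c - y c) <= C * d (g x) (g y)) /\
    (forall B, (forall c, Rabs (x c - y c) <= B) -> d (g x) (g y) <= C * B).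

(** Links the two trees: a set [G] of size [k] corresponds to nodes of length [k] recording the
    images of the first [k] vectors, moved onto [G], with precision 2^-k. *)
Definition realises {M : Type} (d : M -> M -> R) (s : nat -> M) (g : (nat -> R) -> M)
    (G phi : list nat) : Prop :=
  length phi = length G /\
  forall i, (i < length G)%nat ->
    d (s (nth i phi 0%nat)) (g (spread G (ratvec i))) <= (1 / 2) ^ length G.

Lemma realises_exists {M : Type} (d : M -> M -> R) (s : nat -> M) g G :
  is_metric d -> (forall x eps, 0 < eps -> exists n, d x (s n) < eps) ->
  exists phi, realises d s g G phi.
Proof.
  intros Hd Hs.
  destruct (choice (fun i n => d (g (spread G (ratvec i))) (s n) < (1 / 2) ^ length G))
    as [c Hc]; [intro i; apply Hs, half_pow_pos|].
  exists (map c (seq 0 (length G))); split; [now rewrite length_map, length_seq|].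
  intros i Hi; rewrite (nth_indep _ 0%nat (c 0%nat)) by (now rewrite length_map, length_seq).
  rewrite map_nth, seq_nth by auto; left.
  rewrite (proj1 (proj2 (proj2 Hd))); apply Hc.
Qed.

Lemma SQ_spread t G E i : Schreier t (G ++ E) -> SQ t (spread G (ratvec i)).
Proof.
  intro H; exists (G ++ E); split; [auto|split].
  - intros p Hp; apply spread_out; intro Hin; apply Hp, in_or_app; auto.
  - intro p; destruct (spread_cases G (ratvec i) (ratvec i) p) as [[-> _]|[j [-> _]]].
    + exists 0%Q; now rewrite RMicromega.Q2R_0.
    + apply ratvec_rational.
Qed.

(** An old entry approximates the same point at both nodes, so it moves by at most (1 + 1/2) 2^-k,
    where k = [length G]. Spreading the vectors onto the longer set is isometric, so [g] supplies
    the estimates; replacing two images by approximations costs [2 * e], and at most [2 * C * e]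
    after multiplication by [C]. *)
Lemma child_of_realises {M : Type} (d : M -> M -> R) (s : nat -> M) C t g G m E phi phi' :
  is_metric d -> 1 <= C -> SQ_emb d C t g -> Schreier t ((G ++ m :: nil) ++ E) ->
  NoDup (G ++ m :: nil) ->
  realises d s g G phi -> realises d s g (G ++ m :: nil) phi' -> child d s C phi' phi.
Proof.
  intros (_ & _ & Hs & Ht) HC Hg HE Hnd [Hl H] [Hl' H'].
  assert (HlG : length (G ++ m :: nil) = S (length G)) by (rewrite length_app; simpl; lia).
  split; [lia|split].
  - intros i Hi; rewrite Hl in Hi; specialize (H i Hi).
    specialize (H' i ltac:(lia)).
    rewrite spread_app in H' by (intros j Hj; apply ratvec_support; lia).
    rewrite HlG in H'; simpl pow in H'; rewrite Hl.
    set (z := g (spread G (ratvec i))) in *.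
    pose proof (Ht (s (nth i phi 0%nat)) z (s (nth i phi' 0%nat))).
    rewrite (Hs z) in *; pose proof (half_pow_pos (length G)); lra.
  - rewrite Hl'; intros i j Hi Hj.
    set (G' := G ++ m :: nil) in *.
    assert (Hi' := H' i Hi); assert (Hj' := H' j Hj).
    destruct (Hg _ _ (SQ_spread t G' E i HE) (SQ_spread t G' E j HE)) as [H1 H2].
    set (x := g (spread G' (ratvec i))) in *; set (y := g (spread G' (ratvec j))) in *.
    set (x' := s (nth i phi' 0%nat)) in *; set (y' := s (nth j phi' 0%nat)) in *.
    set (e := (1 / 2) ^ length G') in *.
    assert (He : 0 < e) by apply half_pow_pos.
    pose proof (Ht x x' y); pose proof (Ht x' y' y).
    pose proof (Ht x' x y'); pose proof (Ht x y y').
    rewrite (Hs x x'), (Hs y y') in *.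
    split.
    + intro c; destruct (Nat.lt_ge_cases c (length G')) as [Hc|Hc].
      * specialize (H1 (nth c G' 0%nat)); rewrite !spread_nth in H1 by auto; nra.
      (* Both vectors vanish at [c]; [H1] at 0 only provides that [C * d x y] is nonnegative. *)
      * rewrite !ratvec_support by lia; specialize (H1 0%nat).
        pose proof (Rabs_pos (spread G' (ratvec i) 0%nat - spread G' (ratvec j) 0%nat)).
        rewrite Rminus_0_r, Rabs_R0; nra.
    + intros B HB; assert (HxyB : d x y <= C * B); [|nra].
      apply H2; intro c.
      destruct (spread_cases G' (ratvec i) (ratvec j) c) as [[-> ->]|[b [-> ->]]]; auto.
      apply Rle_trans with (2 := HB 0%nat); rewrite Rminus_0_r, Rabs_R0; apply Rabs_pos.
Qed.

(** Well-founded recursion: the bound at [phi] is a successor above the bounds of all its children,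
    which are countably many since nodes are finite lists of naturals. It is chosen before [a], [g]
    and [G], hence is uniform over all embeddings with constant [C]. *)
Lemma well_founded_bound {M : Type} (d : M -> M -> R) (s : nat -> M) C :
  is_metric d -> (forall x eps, 0 < eps -> exists n, d x (s n) < eps) -> 1 <= C ->
  forall phi, Acc (child d s C) phi ->
  exists t, valid t /\ forall a g G N,
    SQ_emb d C a g -> NoDup G -> (forall m, In m G -> (m <= N)%nat) ->
    realises d s g G phi -> ~ rank_ge t (fun E => Schreier a (G ++ E)) N.
Proof.
  intros Hd Hs HC phi Hphi; induction Hphi as [phi _ IH].
  set (bounds := fun t phi' => forall a g G N,
    SQ_emb d C a g -> NoDup G -> (forall m, In m G -> (m <= N)%nat) ->
    realises d s g G phi' -> ~ rank_ge t (fun E => Schreier a (G ++ E)) N) in *.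
  set (node := enum_list (fun n : nat => n)).
  destruct (choice (fun n t => valid t /\ (child d s C (node n) phi -> bounds t (node n))))
    as [t Ht].
  { intro n; destruct (classic (child d s C (node n) phi)) as [Hn|Hn].
    - destruct (IH _ Hn) as (t & Ht & Hb); exists t; auto.
    - exists OZ; split; [exact I|tauto]. }
  destruct (countable_upper_bound t) as (b & Hb & Htb); [apply Ht|].
  exists (OS (OL b)); split; [exact Hb|].
  intros a g G N Hg HG HN Hr (m & Hm & H).
  assert (HG' : NoDup (G ++ m :: nil)).
  { apply NoDup_app; [auto|repeat constructor; auto|].
    intros x Hx [<-|[]]; specialize (HN _ Hx); lia. }
  assert (HN' : forall x, In x (G ++ m :: nil) -> (x <= m)%nat).
  { intros x Hx; apply in_app_or in Hx; destruct Hx as [Hx|[<-|[]]]; [|lia].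
    specialize (HN x Hx); lia. }
  assert (H' : rank_ge (OL b) (fun E => Schreier a ((G ++ m :: nil) ++ E)) m).
  { revert H; apply rank_ge_mono; [lia|]; intros E _; now rewrite <- app_assoc. }
  destruct (realises_exists d s g (G ++ m :: nil) Hd Hs) as [phi' Hr'].
  destruct (enum_list_onto (fun n : nat => n) phi') as [n Hn]; rewrite map_id in Hn.
  (* Rank at least zero produces [E] making [G ++ m :: nil] an initial segment of a member, so that
     [g] controls the vectors spread on it. *)
  destruct (rank_ge_ole _ _ (ole_Z (OL b)) _ _ H') as (E & _ & HE).
  destruct (Ht n) as [_ Hbn]; unfold node in Hbn; rewrite Hn in Hbn.
  apply (Hbn (child_of_realises d s C a g G m E phi phi' Hd HC Hg HE HG' Hr Hr')
    a g (G ++ m :: nil) m Hg HG' HN' Hr').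
  exact (rank_ge_ole _ _ (Htb n) _ _ (H' n)).
Qed.

Lemma SQ_bounded t x : SQ t x -> exists B, forall i, Rabs (x i) <= B.
Proof.
  intros (G & _ & HG & _).
  assert (H : exists B, 0 <= B /\ forall i, In i G -> Rabs (x i) <= B).
  { clear HG; induction G as [|m G (B & HB & IH)]; [exists 0; simpl; intuition lra|].
    exists (Rmax B (Rabs (x m))); split; [apply Rle_trans with (1 := HB), Rmax_l|].
    intros i [<-|Hi]; [apply Rmax_r|].
    apply Rle_trans with (1 := IH i Hi), Rmax_l. }
  destruct H as (B & HB & H); exists B; intro i.
  destruct (classic (In i G)) as [Hi|Hi]; [auto|].
  now rewrite HG, Rabs_R0.
Qed.

Lemma SQ_emb_of_bilip {M : Type} (d : M -> M -> R) (o : M) t :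
  is_metric d -> bilip_embeds (dSQ t) d -> exists n g, SQ_emb d (INR n + 1) t g.
Proof.
  intros Hd (f & s & D & Hs & HD & Hf).
  (* One integer constant absorbs both the scaling and the distortion, leaving only countably many
     constants to consider. *)
  destruct (INR_unbounded (Rmax (/ s) (s * D))) as [n Hn].
  pose proof (Rmax_l (/ s) (s * D)); pose proof (Rmax_r (/ s) (s * D)).
  exists n, (fun x => match excluded_middle_informative (SQ t x) with
                      | left h => f (exist _ x h)
                      | right _ => o
                      end).
  intros x y Hx Hy.
  destruct (excluded_middle_informative (SQ t x)) as [hx|]; [|contradiction].
  destruct (excluded_middle_informative (SQ t y)) as [hy|]; [|contradiction].
  destruct (Hf (exist _ x hx) (exist _ y hy)) as [H1 H2].
  unfold dSQ in H1, H2; simpl in H1, H2.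
  set (e := d _ _) in *; assert (He : 0 <= e) by apply Hd.
  split.
  - destruct (SQ_bounded t x Hx) as [Bx HBx], (SQ_bounded t y Hy) as [By HBy].
    destruct (dinf_spec x y (Bx + By)) as [Hi _].
    { intro i; apply Rle_trans with (1 := Rabs_triang (x i) (- y i)).
      rewrite Rabs_Ropp; now apply Rplus_le_compat. }
    intro c; apply Rle_trans with (/ s * e).
    + apply Rmult_le_reg_l with s; [auto|].
      rewrite <- Rmult_assoc, Rinv_r, Rmult_1_l by lra.
      apply Rle_trans with (2 := H1), Rmult_le_compat_l; [lra|auto].
    + apply Rmult_le_compat_r; lra.
  - intros B HB; destruct (dinf_spec x y B HB) as [Hi HdB].
    pose proof (Rle_trans _ _ _ (Rabs_pos _) (HB 0%nat)) as HB0.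
    apply Rle_trans with (1 := H2), Rle_trans with (s * D * B).
    + apply Rmult_le_compat_l; [|auto].
      apply Rmult_le_pos; lra.
    + apply Rmult_le_compat_r; lra.
Qed.

Lemma ratvec_embedding {M : Type} (d : M -> M -> R) (o : M) (T : Ord -> Prop) :
  is_metric d -> complete d -> separable d -> fundamental_system T ->
  (forall t, T t -> bilip_embeds (dSQ t) d) ->
  exists C f, 1 <= C /\ forall k, rough_emb d C 0 k f.
Proof.
  intros Hd Hc [s' Hs'] (_ & _ & HT & _) Hemb.
  set (s := fun n => match s' n with Some x => x | None => o end).
  assert (Hs : forall x eps, 0 < eps -> exists n, d x (s n) < eps).
  { intros x eps Heps; destruct (Hs' x eps Heps) as (n & y & Hn & Hy).
    exists n; unfold s; now rewrite Hn. }
  assert (HC : forall n, 1 <= INR n + 1) by (intro n; pose proof (pos_INR n); lra).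
  apply NNPP; intro Hno.
  assert (Hacc : forall n, Acc (child d s (INR n + 1)) nil).
  { intro n; apply NNPP; intro H.
    destruct (embedding_of_branch d s (INR n + 1) Hd Hc (HC n) H) as [f Hf].
    apply Hno; exists (INR n + 1), f; auto. }
  destruct (choice _ (fun n => well_founded_bound d s _ Hd Hs (HC n) nil (Hacc n)))
    as [t Ht].
  (* The constant for [u] is known only after [u] is chosen, so [u] must exceed the bounds for all
     integer constants at once. *)
  destruct (countable_upper_bound t) as (b & Hb & Htb); [apply Ht|].
  destruct (HT (OL b) Hb) as (u & Hu & Hbu & _).
  destruct (SQ_emb_of_bilip d o u Hd (Hemb u Hu)) as (n & g & Hg).
  apply (proj2 (Ht n) u g nil 0%nat Hg (NoDup_nil _)).
  - intros m [].
  - split; [reflexivity|]; intros i Hi; simpl in Hi; lia.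
  - pose proof (rank_ge_ole _ _ Hbu _ _ (rank_ge_Schreier u 0)) as H.
    exact (rank_ge_ole _ _ (Htb n) _ _ (H n)).
Qed.

(** * Extension from rational vectors to arbitrary separable spaces *)

Theorem theoremA (M : Type) (d : M -> M -> R) :
  is_metric d -> complete d -> separable d ->
  forall T : Ord -> Prop, fundamental_system T ->
  (forall t, T t -> bilip_embeds (dSQ t) d) ->
  forall (X : Type) (dX : X -> X -> R), is_metric dX -> separable dX ->
    bilip_embeds dX d.
Proof.
  intros Hd Hc Hsep T HT Hemb X dX HdX HsX.
  assert (HM : exists o : M, True).
  { destruct HT as (_ & _ & HT & _); destruct (HT OZ I) as (u & Hu & _).
    destruct (Hemb u Hu) as (f & _).
    assert (H0 : SQ u (fun _ => 0)).
    { exists (1 :: nil)%nat; split; [now apply Schreier_singleton|split; [auto|]].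
      intro i; exists 0%Q; now rewrite RMicromega.Q2R_0. }
    exists (f (exist _ _ H0)); exact I. }
  destruct HM as [o _].
  destruct (classic (exists x : X, True)) as [[o' _]|Hempty].
  2:{ exists (fun _ => o), 1, 1; repeat split; try lra; exfalso; eauto. }
  destruct (ratvec_embedding d o T Hd Hc Hsep HT Hemb) as (C & f & HC & Hf).
  destruct (aharoni dX o' HdX HsX) as (F & HF0 & HFu & HFl).
  assert (He : forall n, 0 < (1 / 2) ^ n / C).
  { intro n; apply Rdiv_lt_0_compat; [apply half_pow_pos|lra]. }
  assert (HeC : forall n, C * ((1 / 2) ^ n / C) = (1 / 2) ^ n) by (intro n; field; lra).
  assert (Hea : forall n, (1 / 2) ^ n / C <= (1 / 2) ^ n).
  { intro n; pose proof (HeC n); pose proof (He n); nra. }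
  (* Precision 2^-n / C is chosen because [f] is [C]-Lipschitz: images of consecutive approximations
     are then within 2 units of 2^-n, as [fast_cauchy_limit] requires. *)
  destruct (choice (fun x (c : nat -> nat) => forall n j,
    Rabs (F x j - ratvec (c n) j) <= (1 / 2) ^ n / C)) as [c Hcx].
  { intro x; apply (choice (fun n i => forall j,
      Rabs (F x j - ratvec i j) <= (1 / 2) ^ n / C)).
    intro n; now apply ratvec_dense. }
  assert (Hup : forall i j B, (forall k, Rabs (ratvec i k - ratvec j k) <= B) ->
    d (f i) (f j) <= C * B).
  { intros i j B HB; destruct (Hf (S (i + j)) i j ltac:(lia) ltac:(lia)) as [_ H].
    specialize (H B HB); lra. }
  destruct (choice (fun x l => forall n, d (f (c x n)) l <= 4 * (1 / 2) ^ n)) as [h Hh].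
  { intro x; apply (fast_cauchy_limit d (fun n => f (c x n)) Hd Hc); intro n.
    rewrite <- HeC, <- Rmult_assoc, (Rmult_comm 2 C), Rmult_assoc; apply Hup; intro k.
    pose proof (Hcx x n k) as H1; pose proof (Hcx x (S n) k) as H2.
    assert (H3 : (1 / 2) ^ S n / C = (1 / 2) ^ n / C / 2) by (simpl pow; field; lra).
    rewrite H3 in H2; pose proof (He n).
    apply Rabs_le_between in H1; apply Rabs_le_between in H2; apply Rabs_le; lra. }
  assert (Hlim : forall x y n,
    Rabs (d (f (c x n)) (f (c y n)) - d (h x) (h y)) <= 8 * (1 / 2) ^ n).
  { intros x y n; pose proof (Hh x n); pose proof (Hh y n).
    destruct Hd as (_ & _ & Hs & Ht).
    set (x' := f (c x n)) in *; set (y' := f (c y n)) in *.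
    pose proof (Ht x' (h x) y'); pose proof (Ht (h x) (h y) y').
    pose proof (Ht (h x) x' (h y)); pose proof (Ht x' y' (h y)).
    rewrite (Hs (h x) x'), (Hs (h y) y') in *; apply Rabs_le; lra. }
  (* The lower estimate loses 12 from the embedding into c_0 and [C] from [f]; the upper Lipschitz
     constant s D is just [C]. *)
  exists h, (/ (12 * C)), (12 * C * C).
  assert (HsC : 0 < / (12 * C)) by (apply Rinv_0_lt_compat; lra).
  split; [auto|split; [nra|]]; intros x y; split.
  - apply Rmult_le_reg_l with (12 * C); [lra|].
    rewrite <- Rmult_assoc, Rinv_r, Rmult_1_l by lra.
    (* Errors in units of 2^-n: [8 * C] from the limits and 2, at most [2 * C], from the rational
       approximations, all multiplied by 12. *)
    apply le_of_half_pow with (12 * (10 * C)); [lra|]; intro n.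
    destruct (HFl x y) as [i Hi].
    destruct (Hf (S (c x n + c y n)) (c x n) (c y n) ltac:(lia) ltac:(lia)) as [H _].
    specialize (H i); pose proof (Hcx x n i) as H1; pose proof (Hcx y n i) as H2.
    pose proof (Hlim x y n) as H3; apply Rabs_le_between in H3.
    pose proof (Hea n); pose proof (half_pow_pos n).
    assert (HF : Rabs (F x i - F y i) <=
      Rabs (ratvec (c x n) i - ratvec (c y n) i) + 2 * (1 / 2) ^ n).
    { replace (F x i - F y i) with ((F x i - ratvec (c x n) i) +
        (ratvec (c x n) i - ratvec (c y n) i) + (ratvec (c y n) i - F y i)) by lra.
      apply Rle_trans with (1 := Rabs_triang _ _).
      rewrite (Rabs_minus_sym (ratvec (c y n) i) (F y i)).
      pose proof (Rabs_triang (F x i - ratvec (c x n) i)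
        (ratvec (c x n) i - ratvec (c y n) i)); lra. }
    nra.
  - replace (/ (12 * C) * (12 * C * C)) with C by (field; lra).
    apply le_of_half_pow with (8 + 2 * C); [lra|]; intro n.
    assert (H : d (f (c x n)) (f (c y n)) <= C * (dX x y + 2 * (1 / 2) ^ n)).
    { apply Hup; intro k; pose proof (Hcx x n k) as H1; pose proof (Hcx y n k) as H2.
      pose proof (HFu x y k) as H3; pose proof (Hea n).
      apply Rabs_le_between in H1; apply Rabs_le_between in H2;
        apply Rabs_le_between in H3; apply Rabs_le; lra. }
    pose proof (Hlim x y n) as H3; apply Rabs_le_between in H3; lra.
Qed.
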